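(* Let $\mathbb{F}$ be a division ring, $\sigma:\mathbb{F}\to\mathbb{F}$ a ring endomorphism, $\delta:\mathbb{F}\to\mathbb{F}$ a $\sigma$-derivation, and $\mathcal{R}=\mathbb{F}[x;\sigma,\delta]$. Let $f,g\in\mathcal{R}$ be non-constant skew polynomials of degrees $m$ and $n$, respectively. The following conditions are equivalent: 1) $R^{\sigma,\delta}_{\mathbb{F}}(f,g)=0$; 2) $f$ and $g$ have a common (non-unit) right factor in $\mathcal{R}$; 3) $\mathrm{gcrd}(f,g)\neq 1$, where gcrd denotes the greatest common right divisor; 4) there are no polynomials $p,q\in\mathcal{R}$ such that $pf+qg=1$; 5) $\mathcal{R}f+\mathcal{R}g\subsetneq\mathcal{R}$.
   Context: A $\sigma$-derivation is an additive map $\delta:\mathbb{F}\to\mathbb{F}$ with $\delta(ab)=\sigma(a)\delta(b)+\delta(a)b$ for all $a,b\in\mathbb{F}$ ($\sigma$ a non-zero ring endomorphism). The skew polynomial ring $\mathcal{R}=\mathbb{F}[x;\sigma,\delta]$ is the set of polynomials $\sum_i a_ix^i$ ($a_i\in\mathbb{F}$) with usual addition and multiplication determined by $xa=\sigma(a)x+\delta(a)$ for $a\in\mathbb{F}$. Right division with remainder holds in $\mathcal{R}$, and every left ideal is principal; $\mathrm{gcrd}(f,g)$ is the monic generator of $\mathcal{R}f+\mathcal{R}g$. Right $(\sigma,\delta)$-resultant: for $f=\sum_{i=0}^m a_ix^i$ and $g=\sum_{j=0}^n b_jx^j$ in $\mathcal{R}$ of degrees $m,n\ge 0$, the right $(\sigma,\delta)$-Sylvester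 matrix $\mathrm{Sylv}^{\sigma,\delta}_{\mathbb{F}}(f,g)$ is the $(m+n)\times(m+n)$ matrix over $\mathbb{F}$ whose rows are, in order, the vectors of left coefficients with respect to $1,x,\dots,x^{m+n-1}$ of $f,xf,\dots,x^{n-1}f,g,xg,\dots,x^{m-1}g$. Explicitly, the coefficient of $x^q$ in $x^pf$ is $\sum_{l=0}^{p}\mathcal{C}_{p-l,l}(a_{q-l})$ (with $a_j=0$ for $j\notin\{0,\dots,m\}$), where $\mathcal{C}_{d,s}(a)$ is the sum of all possible compositions of $d$ copies of $\delta$ and $s$ copies of $\sigma$ evaluated at $a$, and $\mathcal{C}_{0,0}(a)=a$; similarly for $g$. The right $(\sigma,\delta)$-resultant $R^{\sigma,\delta}_{\mathbb{F}}(f,g)$ is the Dieudonné determinant of $\mathrm{Sylv}^{\sigma,\delta}_{\mathbb{F}}(f,g)$, which takes values in $\{0\}\cup\mathbb{F}^*/[\mathbb{F}^*,\mathbb{F}^*]$ and is $0$ exactly when the matrix is singular. *)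

(* Defs.v *)
From HB Require Import structures.
From mathcomp Require Import all_boot all_order all_algebra.
From mathcomp Require Import boolp classical_sets.

Set Implicit Arguments.
Unset Strict Implicit.
Unset Printing Implicit Defensive.

Import GRing.Theory.
Local Open Scope ring_scope.

(* A division ring is a [unitRingType] F (not assumed commutative) together
   with a proof of [GRing.field_axiom F], i.e. every x != 0 is a unit.  A
   nonzero, multiplicative, additive self-map of a division ring preserves 1,
   so the endomorphisms sigma are the unital ones. *)

Record skew_derivation (F : nzRingType) (sigma : {rmorphism F -> F}) :=
  SkewDerivation {
    skew_der :> {additive F -> F};
    skew_derM : forall a b : F,
      skew_der (a * b) = sigma a * skew_der b + skew_der a * b }.

(* F[x; sigma, delta] has the left F-module structure of {poly F}, with      *)
(* coefficients on the left, but its own product [skew_mul]; the phantom     *)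
(* parameter delta selects the latter, so a product must be elaborated at    *)
(* type [skewpoly delta] and not at {poly F}.                                *)

Definition skewpoly (F : nzRingType) (sigma : {rmorphism F -> F})
  (delta : skew_derivation sigma) : Type := {poly F}.

Section SkewRing.
Variables (F : nzRingType) (sigma : {rmorphism F -> F}).
Variable delta : skew_derivation sigma.

HB.instance Definition _ := GRing.Lmodule.copy (skewpoly delta) {poly F}.

(* x g = sum_j (sigma(b_j) x + delta(b_j)) x^j *)
Definition skew_mulX (g : {poly F}) : {poly F} :=
  map_poly sigma g * 'X + map_poly delta g.

(* (sum_i a_i x^i) g = sum_i a_i (x^i g) *)
Definition skew_mul (f g : {poly F}) : {poly F} :=
  \sum_(i < size f) f`_i *: iter i skew_mulX g.

Fact skew_mulX_zmod : zmod_morphism skew_mulX.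
Proof.
move=> p q; rewrite /skew_mulX !raddfB mulrBl opprD !addrA; congr (_ - _).
by rewrite addrAC.
Qed.
HB.instance Definition _ :=
  GRing.isZmodMorphism.Build {poly F} {poly F} skew_mulX skew_mulX_zmod.

Lemma coef_skew_mulX (g : {poly F}) i :
  (skew_mulX g)`_i = (if i is j.+1 then sigma g`_j else 0) + delta g`_i.
Proof.
rewrite /skew_mulX coefD coefMX [in X in _ + X]coef_map_id0 ?raddf0 //.
by case: i => [|i] //=; rewrite coef_map_id0 ?raddf0.
Qed.

Lemma skew_mulXZ a (g : {poly F}) :
  skew_mulX (a *: g) = sigma a *: skew_mulX g + delta a *: g.
Proof.
apply/polyP=> -[|i]; rewrite [RHS]coefD ![in RHS]coefZ !coef_skew_mulX !coefZ skew_derM mulrDr addrA.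
  by rewrite mulr0.
by rewrite rmorphM.
Qed.

Lemma skew_mul_coef n (f g : {poly F}) : (size f <= n)%N ->
  skew_mul f g = \sum_(i < n) f`_i *: iter i skew_mulX g.
Proof.
move=> le_f_n; rewrite /skew_mul.
rewrite (big_ord_widen n (fun i => f`_i *: iter i skew_mulX g) le_f_n) big_mkcond.
apply: eq_bigr => i _; case: ltnP => // /(nth_default 0) ->.
by rewrite scale0r.
Qed.

Lemma skew_mulDl : left_distributive skew_mul +%R.
Proof.
move=> f1 f2 g; pose n := maxn (size f1) (size f2).
rewrite !(@skew_mul_coef n) ?leq_maxl ?leq_maxr ?size_polyD // -big_split /=.
by apply: eq_bigr => i _; rewrite coefD scalerDl.
Qed.

Lemma iter_skew_mulXD i : {morph iter i skew_mulX : g h / g + h}.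
Proof. by move=> g h; elim: i => //= i ->; rewrite raddfD. Qed.

Lemma skew_mulDr : right_distributive skew_mul +%R.
Proof.
move=> f g1 g2; rewrite /skew_mul -big_split /=.
by apply: eq_bigr => i _; rewrite iter_skew_mulXD scalerDr.
Qed.

Lemma skew_mulZl a (f g : {poly F}) : skew_mul (a *: f) g = a *: skew_mul f g.
Proof.
rewrite (@skew_mul_coef (size f)) ?size_scale_leq // scaler_sumr.
by apply: eq_bigr => i _; rewrite coefZ scalerA.
Qed.

Lemma skew_mul0l g : skew_mul 0 g = 0.
Proof. by rewrite /skew_mul size_poly0 big_ord0. Qed.

Lemma skew_mulXnl i (g : {poly F}) : skew_mul 'X^i g = iter i skew_mulX g.
Proof.
rewrite (@skew_mul_coef i.+1) ?size_polyXn // big_ord_recr /= coefXn eqxx scale1r.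
rewrite big1 ?add0r // => j _.
by rewrite coefXn (ltn_eqF (ltn_ord j)) scale0r.
Qed.

Lemma skew_mulXA (f g : {poly F}) :
  skew_mul (skew_mulX f) g = skew_mulX (skew_mul f g).
Proof.
pose u i := if i is j.+1 then sigma f`_j else 0.
have size_le : (size (skew_mulX f) <= (size f).+1)%N.
  apply/leq_sizeP=> i; rewrite coef_skew_mulX.
  by case: i => [//|i] lt_f_i; rewrite !nth_default ?raddf0 ?addr0 // ltnW.
rewrite (skew_mul_coef _ size_le) (@skew_mul_coef (size f) f) // raddf_sum /=.
under eq_bigr => i _ do rewrite coef_skew_mulX scalerDl.
under [RHS]eq_bigr => i _ do rewrite skew_mulXZ -iterS.
rewrite !big_split /= big_ord_recl scale0r add0r; congr (_ + _).
by rewrite big_ord_recr /= nth_default // raddf0 scale0r addr0.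
Qed.

Lemma skew_mulA : associative skew_mul.
Proof.
move=> f g h; rewrite {1}/skew_mul [skew_mul f g]/skew_mul.
have skew_mul_suml : {morph skew_mul^~ h : p q / p + q} by move=> p q; apply: skew_mulDl.
rewrite (big_morph _ skew_mul_suml (skew_mul0l h)); apply: eq_bigr => i _.
rewrite skew_mulZl; congr (_ *: _).
by elim: (nat_of_ord i) => //= k ->; rewrite skew_mulXA.
Qed.

Lemma skew_mul1l : left_id 1 skew_mul.
Proof. by move=> g; exact: (skew_mulXnl 0 g). Qed.

Lemma skew_der1 : delta 1 = 0.
Proof.
have := skew_derM delta 1 1; rewrite !mulr1 rmorph1 mul1r.
by move/(congr1 (fun z => z - delta 1)); rewrite addrK subrr.
Qed.

Lemma iter_skew_mulX1 i : iter i skew_mulX 1 = 'X^i.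
Proof.
elim: i => //= i ->; apply/polyP=> j; rewrite coef_skew_mulX !coefXn.
have -> : delta (j == i)%:R = 0 by case: eqP; rewrite ?raddf0 ?skew_der1.
by case: j => [|j]; rewrite addr0 // coefXn rmorph_nat.
Qed.

Lemma skew_mul1r : right_id 1 skew_mul.
Proof.
move=> f; rewrite /skew_mul -[RHS]coefK poly_def.
by apply: eq_bigr => i _; rewrite iter_skew_mulX1.
Qed.

HB.instance Definition _ := GRing.Zmodule_isNzRing.Build (skewpoly delta)
  skew_mulA skew_mul1l skew_mul1r skew_mulDl skew_mulDr (oner_neq0 {poly F}).

End SkewRing.

Section SkewTheory.
Variables (F : nzRingType) (sigma : {rmorphism F -> F}).
Variable delta : skew_derivation sigma.
Local Notation R := (skewpoly delta).

Definition skewC (a : F) : R := a%:P.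
Definition skewX : R := 'X.

Definition skew_coef (f : R) (i : nat) : F := (f : {poly F})`_i.

(* Degree; only meaningful for f != 0. *)
Definition skew_deg (f : R) : nat := (size (f : {poly F})).-1.

Definition skew_monic (f : R) : bool := (f : {poly F}) \is monic.

Lemma skewC_mul (a : F) (f : R) : skewC a * f = a *: f.
Proof.
rewrite /skewC -alg_polyC -[LHS]/(skew_mul delta (a *: 1) f).
by rewrite skew_mulZl skew_mul1l.
Qed.

Lemma skewX_mul (f : R) : skewX * f = skew_mulX delta f.
Proof. exact: (skew_mulXnl delta 1 f). Qed.

Lemma skewXn_mul n (f : R) : skewX ^+ n * f = iter n (skew_mulX delta) f.
Proof.
by elim: n => [|n IHn]; rewrite ?mul1r // exprS -mulrA IHn skewX_mul.
Qed.

Lemma skew_commutation (a : F) :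
  skewX * skewC a = skewC (sigma a) * skewX + skewC (delta a).
Proof.
rewrite skewX_mul skewC_mul /skew_mulX /skewC !map_polyC.
by rewrite -mul_polyC.
Qed.

Lemma skew_expansion (f : R) :
  f = \sum_(i < (skew_deg f).+1) skewC (skew_coef f i) * skewX ^+ i.
Proof.
have skewXnE n : skewX ^+ n = 'X^n.
  by rewrite -[LHS]mulr1 skewXn_mul iter_skew_mulX1.
under eq_bigr => i _ do rewrite skewC_mul skewXnE.
rewrite -[LHS](@coefK F) poly_def /skew_deg.
have [->|f_neq0] := eqVneq (f : {poly F}) 0.
  by rewrite size_poly0 big_ord0 big_ord1 /skew_coef coef0 scale0r.
by rewrite prednK // lt0n size_poly_eq0.
Qed.

Definition left_ideal1 (d : R) : set R :=
  [set h | exists p : R, h = p * d]%classic.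

Definition left_ideal2 (f g : R) : set R :=
  [set h | exists p q : R, h = p * f + q * g]%classic.

(* The monic generator of R f + R g: over a division ring it exists unless   *)
(* f = g = 0 (lemma [gcrdP]), and it is unique ([monic_generator_unique]).   *)
Definition gcrd (f g : R) : R :=
  xget 0 [set d | skew_monic d /\ left_ideal1 d = left_ideal2 f g]%classic.

Definition right_factor (h f : R) : Prop := exists u : R, f = u * h.

Definition skew_unit (h : R) : Prop := exists k : R, k * h = 1 /\ h * k = 1.

End SkewTheory.

Section Gcrd.
Variables (F : nzRingType) (sigma : {rmorphism F -> F}).
Variable delta : skew_derivation sigma.
Local Notation R := (skewpoly delta).
Local Notation T := (skew_mulX delta).

Lemma skew_mulX_monic (d : {poly F}) :
  d \is monic -> T d \is monic /\ size (T d) = (size d).+1.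
Proof.
move=> d_monic; have d_gt0 : (0 < size d)%N by rewrite size_poly_gt0 monic_neq0.
have topE : (T d)`_(size d) = 1.
  rewrite coef_skew_mulX [d`_(size d)]nth_default // raddf0 addr0.
  rewrite -(prednK d_gt0) -[d`__]/(lead_coef d) (monicP d_monic).
  by rewrite rmorph1.
have sizeE : size (T d) = (size d).+1.
  apply/eqP; rewrite eqn_leq; apply/andP; split; last first.
    rewrite ltnNge; apply/negP=> /(nth_default 0) /eqP.
    by rewrite topE oner_eq0.
  apply/leq_sizeP=> -[//|i] le_d_i; rewrite coef_skew_mulX.
  by rewrite !nth_default ?raddf0 ?addr0 // ltnW.
by split=> //; rewrite monicE lead_coefE sizeE topE.
Qed.

Lemma iter_skew_mulX_monic k (d : {poly F}) :
  d \is monic -> iter k T d \is monic /\ size (iter k T d) = (size d + k)%N.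
Proof.
move=> d_monic; elim: k => [|k [mon sz]]; first by rewrite addn0.
by have [mon' sz'] := skew_mulX_monic mon; rewrite /= sz' sz addnS.
Qed.

Lemma size_skew_mul_monic (p d : {poly F}) : p != 0 -> d \is monic ->
  ((size p).-1 + size d <= size (skew_mul delta p d))%N.
Proof.
move=> p_neq0 d_monic; have p_gt0 : (0 < size p)%N by rewrite size_poly_gt0.
have d_gt0 : (0 < size d)%N by rewrite size_poly_gt0 monic_neq0.
rewrite -(prednK d_gt0) addnS ltnNge; apply/negP=> /(nth_default 0).
have le_p : (size p <= (size p).-1.+1)%N by rewrite prednK.
rewrite (skew_mul_coef delta d le_p).
rewrite coef_sum big_ord_recr /= big1 ?add0r => [|i _]; last first.
  rewrite coefZ [X in _ * X]nth_default ?mulr0 //.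
  have [_ ->] := iter_skew_mulX_monic i d_monic.
  by rewrite -{1}(prednK d_gt0) addSnnS addnC leq_add2r.
have [mon sz] := iter_skew_mulX_monic (size p).-1 d_monic.
rewrite coefZ; have -> : ((size p).-1 + (size d).-1)%N = (size (iter (size p).-1 T d)).-1.
  by rewrite sz -{2}(prednK d_gt0) addSn addnC.
rewrite -!lead_coefE (monicP mon) mulr1 => /eqP.
by rewrite lead_coef_eq0 (negPf p_neq0).
Qed.

Lemma skew_divr_monic (d h : R) : skew_monic d ->
  exists q : R, (size ((h - q * d : R)%R : {poly F}) < size (d : {poly F}))%N.
Proof.
rewrite /skew_monic => d_monic.
have d_gt0 : (0 < size (d : {poly F}))%N by rewrite size_poly_gt0 monic_neq0.
have [n] := ubnP (size (h : {poly F})); elim: n => // n IHn in h * => lt_h_n.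
have [lt_h_d|le_d_h] := ltnP (size (h : {poly F})) (size (d : {poly F})).
  by exists 0; rewrite mul0r subr0.
pose k := (size (h : {poly F}) - size (d : {poly F}))%N.
pose c := lead_coef (h : {poly F}).
pose q0 : R := skewC delta c * skewX delta ^+ k.
have q0dE : q0 * d = c *: iter k T d.
  by rewrite /q0 -mulrA skewXn_mul skewC_mul.
have [mon sz] := iter_skew_mulX_monic k d_monic.
have szk : size (iter k T d) = size (h : {poly F}) by rewrite sz subnKC.
have h_gt0 : (0 < size (h : {poly F}))%N by exact: leq_trans d_gt0 le_d_h.
have lt_h' : (size ((h - q0 * d : R)%R : {poly F}) < n)%N.
  rewrite ltnS in lt_h_n; apply: leq_trans lt_h_n.
  rewrite -(prednK h_gt0) ltnS.
  apply/leq_sizeP=> j; rewrite q0dE coefB coefZ leq_eqVlt => /predU1P[<-|lt_h_j].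
    rewrite -{2}szk -!lead_coefE (monicP mon) mulr1 /c.
    by rewrite subrr.
  by rewrite prednK // in lt_h_j; rewrite !nth_default ?mulr0 ?subrr // szk.
have [q1 lt_q1] := IHn (h - q0 * d) lt_h'.
by exists (q0 + q1); rewrite mulrDl opprD addrA.
Qed.

Lemma monic_generator_unique (d e : R) : skew_monic d -> skew_monic e ->
  left_ideal1 d = left_ideal1 e -> d = e.
Proof.
rewrite /skew_monic => d_monic e_monic de.
have [u dE] : left_ideal1 e d by rewrite -de; exists 1; rewrite mul1r.
have [v eE] : left_ideal1 d e by rewrite de; exists 1; rewrite mul1r.
have u_neq0 : (u : {poly F}) != 0.
  apply/eqP=> u0; move: (monic_neq0 d_monic).
  by rewrite dE u0 -[_ * _]/(skew_mul delta 0 e) skew_mul0l eqxx.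
have v_neq0 : (v : {poly F}) != 0.
  apply/eqP=> v0; move: (monic_neq0 e_monic).
  by rewrite eE v0 -[_ * _]/(skew_mul delta 0 d) skew_mul0l eqxx.
have le_d := size_skew_mul_monic u_neq0 e_monic.
have le_e := size_skew_mul_monic v_neq0 d_monic.
rewrite -[skew_mul delta u e]/(u * e) -dE in le_d.
rewrite -[skew_mul delta v d]/(v * d) -eE in le_e.
have /size_poly1P[c c_neq0 uC] : size (u : {poly F}) == 1%N.
  have u_gt0 : (0 < size (u : {poly F}))%N by rewrite size_poly_gt0.
  rewrite -(prednK u_gt0) eqSS -leqn0 -(leq_add2r (size (e : {poly F}))) add0n.
  apply: leq_trans le_d _; apply: leq_trans le_e; exact: leq_addl.
move: dE; rewrite uC -[c%:P]/(skewC delta c) skewC_mul => dE.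
have szde : size (d : {poly F}) = size (e : {poly F}).
  apply/eqP; rewrite eqn_leq; apply/andP; split.
    exact: leq_trans (leq_addl _ _) le_e.
  exact: leq_trans (leq_addl _ _) le_d.
have : lead_coef (d : {poly F}) = c.
  by rewrite lead_coefE szde dE coefZ -lead_coefE (monicP e_monic) mulr1.
by rewrite (monicP d_monic) dE => <-; rewrite scale1r.
Qed.

End Gcrd.

Lemma gcrdP (F : unitRingType) (sigma : {rmorphism F -> F})
    (delta : skew_derivation sigma) (f g : skewpoly delta) :
  GRing.field_axiom F -> f != 0 \/ g != 0 ->
  skew_monic (gcrd f g) /\ left_ideal1 (gcrd f g) = left_ideal2 f g.
Proof.
move=> Fdiv fg_neq0; rewrite /gcrd.
suff ex_gen : exists d : skewpoly delta,
    skew_monic d /\ left_ideal1 d = left_ideal2 f g.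
  exact: (@xgetPex _ 0 [set d | skew_monic d /\
    left_ideal1 d = left_ideal2 f g]%classic ex_gen).
have idealB (h k : skewpoly delta) p :
    left_ideal2 f g h -> left_ideal2 f g k -> left_ideal2 f g (h - p * k).
  move=> [a1 [b1 ->]] [a2 [b2 ->]]; exists (a1 - p * a2), (b1 - p * b2).
  by rewrite mulrDr !mulrBl !mulrA opprD addrACA.
have ideal0 : left_ideal2 f g 0 by exists 0, 0; rewrite !mul0r addr0.
have idealM (k p : skewpoly delta) : left_ideal2 f g k -> left_ideal2 f g (p * k).
  by move=> gk; have := idealB 0 k (- p) ideal0 gk; rewrite sub0r mulNr opprK.
pose P n := `[< exists h : skewpoly delta,
  [/\ left_ideal2 f g h, h != 0 & size (h : {poly F}) = n] >].
have exP : exists n, P n.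
  case: fg_neq0 => neq0.
    exists (size (f : {poly F})); apply/asboolP; exists f; split=> //.
    by exists 1, 0; rewrite mul1r mul0r addr0.
  exists (size (g : {poly F})); apply/asboolP; exists g; split=> //.
  by exists 0, 1; rewrite mul1r mul0r add0r.
have [n /asboolP[h [Ih h_neq0 szh]] min_n] := ex_minnP exP.
pose c := lead_coef (h : {poly F}).
have c_unit : c \is a GRing.unit by apply: Fdiv; rewrite lead_coef_eq0.
pose d : skewpoly delta := skewC delta c^-1 * h.
have dE : d = c^-1 *: h :> {poly F} by rewrite /d skewC_mul.
have szd : size (d : {poly F}) = n.
  have lt_cn : (size (d : {poly F}) <= n)%N by rewrite dE -szh size_scale_leq.
  apply/eqP; rewrite eqn_leq lt_cn /=; apply: min_n; apply/asboolP; exists d.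
  split=> //; first exact: idealM.
  apply/eqP=> d0; case/eqP: h_neq0.
  have : c *: (d : skewpoly delta) = h.
    by rewrite dE scalerA mulrV // scale1r.
  by rewrite d0 scaler0 => <-.
have Id : left_ideal2 f g d by apply: idealM.
have d_monic : skew_monic d.
  by rewrite /skew_monic monicE lead_coefE szd dE coefZ -szh -lead_coefE mulVr.
exists d; split=> //; apply/seteqP; split=> k /=; first by case=> p ->; apply: idealM.
move=> Ik; have [q lt_q] := skew_divr_monic k d_monic.
exists q; apply/eqP; rewrite -subr_eq0; apply/negPn/negP=> r_neq0.
move: lt_q; rewrite szd ltnNge => /negP; apply; apply: min_n; apply/asboolP.
by exists (k - q * d); split=> //; apply: idealB.
Qed.

Section Dieudonne.
Local Open Scope quotient_scope.
Variable F : unitRingType.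

Inductive unit_commutator_group : F -> Prop :=
| ucg1 : unit_commutator_group 1
| ucg_comm a b of a \is a GRing.unit & b \is a GRing.unit :
    unit_commutator_group (a * b * a^-1 * b^-1)
| ucgM c d of unit_commutator_group c & unit_commutator_group d :
    unit_commutator_group (c * d)
| ucgV c of unit_commutator_group c : unit_commutator_group c^-1.

Lemma ucg_unit c : unit_commutator_group c -> c \is a GRing.unit.
Proof.
elim=> [|a b ua ub|c1 d _ uc _ ud|c1 _ uc]; rewrite ?unitr1 ?unitrV //.
  by rewrite !unitrMr ?unitrV.
by rewrite unitrMr.
Qed.

Definition dieudonne_eq (x y : F) : bool :=
  `[< exists2 c, unit_commutator_group c & x = y * c >].

Fact dieudonne_eq_refl : reflexive dieudonne_eq.
Proof. by move=> x; apply/asboolP; exists 1; [apply: ucg1 | rewrite mulr1]. Qed.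

Fact dieudonne_eq_sym : symmetric dieudonne_eq.
Proof.
suff sub x y : dieudonne_eq x y -> dieudonne_eq y x.
  by move=> x y; apply/idP/idP; apply: sub.
move=> /asboolP[c Gc ->]; apply/asboolP; exists c^-1; first exact: ucgV.
by rewrite mulrK // ucg_unit.
Qed.

Fact dieudonne_eq_trans : transitive dieudonne_eq.
Proof.
move=> y x z /asboolP[c Gc ->] /asboolP[d Gd ->]; apply/asboolP.
by exists (d * c); [apply: ucgM | rewrite mulrA].
Qed.

Canonical dieudonne_equiv :=
  EquivRel dieudonne_eq dieudonne_eq_refl dieudonne_eq_sym dieudonne_eq_trans.

(* F modulo [F^*, F^*]: over a division ring this is {0} U F^* / [F^*, F^*], *)
(* the class of 0 being {0} (lemma [dieudonne_class_eq0]).                   *)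
Definition dieudonne_value : Type := {eq_quot dieudonne_equiv}.

Definition dieudonne_class (x : F) : dieudonne_value :=
  \pi_({eq_quot dieudonne_equiv}) x.

Lemma dieudonne_class_eq x y :
  dieudonne_class x = dieudonne_class y <->
  exists2 c, unit_commutator_group c & x = y * c.
Proof.
split=> [/eqmodP/asboolP // | xy]; apply/eqmodP; exact/asboolP.
Qed.

Lemma dieudonne_class_eq0 x : dieudonne_class x = dieudonne_class 0 <-> x = 0.
Proof. by split=> [/dieudonne_class_eq[c _ ->]|->] //; rewrite mul0r. Qed.

(* A representative in F of the Dieudonne determinant, by row elimination on *)
(* the first column.  The pivot is its first nonzero entry, in row i; moving *)
(* that row to the top contributes (-1)^i.  Rows are multiplied on the left, *)
(* so clearing the column replaces A_kl by A_kl - A_k0 A_i0^-1 A_il.  Over a *)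
(* division ring another choice of pivots changes the representative but not *)
(* its class modulo [F^*, F^*] (Dieudonne).                                  *)
Fixpoint dieudonne_rep (n : nat) : 'M[F]_n -> F :=
  match n with
  | 0 => fun _ => 1
  | n'.+1 => fun A : 'M[F]_n'.+1 =>
      if [pick i | A i ord0 != 0] is Some i then
        (-1) ^+ i * A i ord0 *
        dieudonne_rep (\matrix_(k < n', l < n')
          (A (lift i k) (lift ord0 l) -
           A (lift i k) ord0 * (A i ord0)^-1 * A i (lift ord0 l)))
      else 0
  end.

Definition dieudonne_det (n : nat) (A : 'M[F]_n) : dieudonne_value :=
  dieudonne_class (dieudonne_rep A).

End Dieudonne.

Section Resultant.
Variables (F : unitRingType) (sigma : {rmorphism F -> F}).
Variable delta : skew_derivation sigma.
Local Notation R := (skewpoly delta).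

(* Rows f, x f, ..., x^(n-1) f, g, x g, ..., x^(m-1) g for m = deg f and    *)
(* n = deg g.                                                               *)
Definition skew_sylvester (f g : R) : 'M[F]_(skew_deg f + skew_deg g) :=
  \matrix_(i, j)
    skew_coef (if (i < skew_deg g)%N then skewX delta ^+ i * f
               else skewX delta ^+ (i - skew_deg g) * g) j.

Definition skew_resultant (f g : R) : dieudonne_value F :=
  dieudonne_det (skew_sylvester f g).

End Resultant.

(* Main.v *)
(* Multiplying a row vector by the Sylvester matrix computes p f + q g, where  *)
(* p and q, of degrees < deg g and < deg f, have the entries of the vector as *)
(* coefficients.  Elimination shows that a square matrix over a division ring *)
(* with nonzero Dieudonne determinant acts onto, so that 1 lies in R f + R g, *)
(* while one with zero determinant kills a nonzero column and does not.       *)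
(* Conversely, if 1 lies in R f + R g then the matrix acts onto: counting     *)
(* dimensions gives a common left multiple s f = t g with deg s <= deg g, and *)
(* reducing modulo s makes the cofactor of f in any h = p f + q g of degree   *)
(* < deg g.  The remaining equivalences come from gcrd(f, g) generating       *)
(* R f + R g, and from a left-invertible element of a domain being a unit.    *)

Require Import Defs.
From mathcomp Require Import all_boot all_order all_algebra.
From mathcomp Require Import boolp classical_sets.

Set Implicit Arguments.
Unset Strict Implicit.
Unset Printing Implicit Defensive.

Import GRing.Theory.
Local Open Scope ring_scope.

(** With m = deg f and n = deg g, the Sylvester matrix represents (p, q) -> pf + qg on deg p < n,
    deg q < m, with values in degree < m + n ([coef_row_mul], [coef_rowP]). By elimination, a
    nonzero [dieudonne_rep] makes this map onto ([dieudonne_rep_neq0_surj]), so 1 is reached; a zero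
    one gives a nonzero column killed by the matrix ([dieudonne_rep_eq0_col]), so the map is not
    onto. An arbitrary identity pf + qg = 1 has cofactors of unbounded degree;
    [left_common_multiple] supplies the s modulo which they are reduced. The other conditions all
    say that the monic generator of Rf + Rg is not 1. *)

Section DivisionRingElimination.

(** * Row elimination over a division ring *)

Variable F : unitRingType.
Hypothesis hF : GRing.field_axiom F.

Lemma field_axiom_mulf_eq0 (a b : F) : a * b = 0 -> a = 0 \/ b = 0.
Proof.
move=> ab0; have [->|a0] := eqVneq a 0; [by left | right].
by rewrite -(mulKr (hF a0) b) ab0 mulr0.
Qed.

(** This is the matrix on which [dieudonne_rep] recurses, made rectangular so that it also serves
    for counting dimensions. *)
Definition schur m n (A : 'M[F]_(m.+1, n.+1)) (i : 'I_m.+1) : 'M[F]_(m, n) :=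
  \matrix_(k, l) (A (lift i k) (lift ord0 l) -
    A (lift i k) ord0 * (A i ord0)^-1 * A i (lift ord0 l)).

(** Column 0 forces the coefficient [x] of the pivot row; eliminating it leaves the Schur system.
    Keeping the entries of [v'] ensures that a nonzero [v'] lifts to a nonzero [v]. *)
Lemma schur_row_solve m n (A : 'M[F]_(m.+1, n.+1)) i (w : 'rV_n.+1)
    (v' : 'rV_m) :
  A i ord0 != 0 ->
  v' *m schur A i =
    \row_l (w 0 (lift ord0 l) - w 0 ord0 * (A i ord0)^-1 * A i (lift ord0 l)) ->
  exists v : 'rV_m.+1, v *m A = w /\ forall k, v 0 (lift i k) = v' 0 k.
Proof.
move=> /hF uA v'E.
pose s := \sum_k v' 0 k * A (lift i k) ord0.
pose x := (w 0 ord0 - s) * (A i ord0)^-1.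
pose v : 'rV_m.+1 := \row_j (if unlift i j is Some k then v' 0 k else x).
have vi : v 0 i = x by rewrite mxE unlift_none.
have vk k : v 0 (lift i k) = v' 0 k by rewrite mxE liftK.
exists v; split=> //; apply/rowP=> j; rewrite mxE (bigD1_ord i) //= vi.
under eq_bigr => k _ do rewrite vk.
case: (unliftP ord0 j) => [l|] ->; last by rewrite -/s mulrVK // subrK.
have /rowP/(_ l) := v'E; rewrite !mxE.
under [X in X = _ -> _]eq_bigr => k _ do rewrite mxE mulrBr !mulrA.
rewrite sumrB -!mulr_suml -/s => /(canRL (subrK _)) ->.
by rewrite /x !mulrBl [X in _ + X]addrC subrKA addrC subrK.
Qed.

(** Induction on columns: a pivot removes one row and one column, and a zero first column is simply
    dropped. *)
Lemma left_kernel_wide m n (A : 'M[F]_(m, n)) : (n < m)%N ->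
  exists2 v : 'rV_m, v != 0 & v *m A = 0.
Proof.
elim: n m A => [|n IHn] [//|m] A lt_nm.
  exists (const_mx 1); last by apply/rowP=> -[].
  by apply/eqP=> /rowP/(_ ord0) /eqP; rewrite !mxE oner_eq0.
have [i Ai0|col0] := pickP (fun i => A i ord0 != 0).
  have [v' v'0 v'A] := IHn m (schur A i) lt_nm.
  have [|v [vA vv']] := @schur_row_solve m n A i 0 v' Ai0.
    by rewrite v'A; apply/rowP=> l; rewrite !mxE !mul0r subr0.
  exists v => //; apply: contraNneq v'0 => v0.
  by apply/eqP/rowP=> k; rewrite -vv' v0 !mxE.
have [v v0 vA] := IHn m.+1 (\matrix_(k, l) A k (lift ord0 l)) (ltnW lt_nm).
exists v => //; apply/rowP=> j; case: (unliftP ord0 j) => [l|] ->.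
  have /rowP/(_ l) := vA; rewrite !mxE => vAl; rewrite -[RHS]vAl.
  by apply: eq_bigr => k _; rewrite mxE.
rewrite !mxE big1 // => k _.
by have /negbFE/eqP -> := col0 k; rewrite mulr0.
Qed.

Lemma dieudonne_rep_neq0_surj n (A : 'M[F]_n) : dieudonne_rep A != 0 ->
  forall w : 'rV_n, exists v : 'rV_n, v *m A = w.
Proof.
elim: n A => [|n IHn] A /=.
  by move=> _ w; exists 0; apply/rowP=> -[].
case: pickP => [i Ai0|_]; last by rewrite eqxx.
rewrite -/(schur A i) => rep0 w.
have /IHn/(_ (\row_l (w 0 (lift ord0 l) -
    w 0 ord0 * (A i ord0)^-1 * A i (lift ord0 l))))[v' v'A] :
    dieudonne_rep (schur A i) != 0.
  by apply: contraNneq rep0 => ->; rewrite mulr0.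
by have [v [vA _]] := schur_row_solve Ai0 v'A; exists v.
Qed.

(** A zero first column kills the first basis vector. Otherwise the Schur complement has zero
    representative, and its kernel column is extended by solving the pivot row for the top entry. *)
Lemma dieudonne_rep_eq0_col n (A : 'M[F]_n) : dieudonne_rep A = 0 ->
  exists2 c : 'cV_n, c != 0 & A *m c = 0.
Proof.
elim: n A => [|n IHn] A /=; first by move/eqP; rewrite oner_eq0.
case: pickP => [i Ai0|col0 _]; last first.
  exists (delta_mx ord0 ord0).
    by apply/eqP=> /colP/(_ ord0) /eqP; rewrite !mxE !eqxx oner_eq0.
  rewrite -colE; apply/colP=> k; rewrite !mxE.
  by have /negbFE/eqP -> := col0 k.
rewrite -/(schur A i) => /field_axiom_mulf_eq0[/field_axiom_mulf_eq0[]|].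
- by move=> /eqP; rewrite signr_eq0.
- by move=> A0; rewrite A0 eqxx in Ai0.
move=> /IHn[c' c'0 Ac'].
pose t := \sum_l A i (lift ord0 l) * c' l 0.
pose c : 'cV_n.+1 :=
  \col_j (if unlift ord0 j is Some l then c' l 0 else - (A i ord0)^-1 * t).
have c0E : c ord0 0 = - (A i ord0)^-1 * t by rewrite mxE unlift_none.
have cl l : c (lift ord0 l) 0 = c' l 0 by rewrite mxE liftK.
exists c.
  apply: contraNneq c'0 => c0.
  by apply/eqP/colP=> l; rewrite -cl c0 !mxE.
apply/colP=> j; rewrite !mxE (bigD1_ord ord0) //= c0E.
under eq_bigr => l _ do rewrite cl.
case: (unliftP i j) => [k|] ->; last first.
  by rewrite -/t mulNr mulrN mulVKr ?hF // addNr.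
have /colP/(_ k) := Ac'; rewrite !mxE.
under [X in X = _ -> _]eq_bigr => l _ do rewrite mxE mulrBl -!mulrA.
rewrite sumrB -!mulr_sumr -/t => Ac'k; rewrite -[RHS]Ac'k.
by rewrite mulNr mulrN addrC.
Qed.

End DivisionRingElimination.

(** * Degrees and division in the skew polynomial ring *)

Section SkewDivisionRing.
Variables (F : unitRingType) (sigma : {rmorphism F -> F}).
Variable delta : skew_derivation sigma.
Hypothesis hF : GRing.field_axiom F.
Local Notation R := (skewpoly delta).
Local Notation T := (skew_mulX delta).

Lemma field_axiom_lreg (a : F) : a != 0 -> GRing.lreg a.
Proof. by move=> a0; apply: mulrI (hF a0). Qed.

Lemma size_skew_mulX (f : {poly F}) : f != 0 -> size (T f) = (size f).+1.
Proof.
move=> f0; have f_gt0 : (0 < size f)%N by rewrite size_poly_gt0.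
apply/eqP; rewrite eqn_leq; apply/andP; split.
  apply/leq_sizeP=> -[//|i] le_f_i; rewrite coef_skew_mulX.
  by rewrite !nth_default ?raddf0 ?addr0 // ltnW.
rewrite ltnNge; apply/negP=> /(nth_default 0).
rewrite coef_skew_mulX [f`_(size f)]nth_default // raddf0 addr0.
rewrite -(prednK f_gt0) -lead_coefE => sl0.
(* [sigma] cannot kill a unit, so the leading coefficient survives. *)
have : sigma (lead_coef f * (lead_coef f)^-1) = 0 by rewrite rmorphM sl0 mul0r.
by rewrite divrr ?hF ?lead_coef_eq0 // rmorph1 => /eqP; rewrite oner_eq0.
Qed.

Lemma size_iter_skew_mulX k (f : {poly F}) :
  f != 0 -> size (iter k T f) = (k + size f)%N.
Proof.
move=> f0; elim: k => //= k IHk; rewrite size_skew_mulX ?IHk //.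
by rewrite -size_poly_gt0 IHk ltn_addl // size_poly_gt0.
Qed.

Lemma size_skew_mul (p f : {poly F}) : p != 0 -> f != 0 ->
  size (skew_mul delta p f) = (size p + size f).-1.
Proof.
move=> p0 f0; have p_gt0 : (0 < size p)%N by rewrite size_poly_gt0.
have f_gt0 : (0 < size f)%N by rewrite size_poly_gt0.
have le_p : (size p <= (size p).-1.+1)%N by rewrite prednK.
rewrite (skew_mul_coef delta f le_p) big_ord_recr /= addrC.
have topE : size (p`_(size p).-1 *: iter (size p).-1 T f) = (size p + size f).-1.
  rewrite lreg_size; last by apply: field_axiom_lreg; rewrite -lead_coefE lead_coef_eq0.
  by rewrite size_iter_skew_mulX // -[in RHS](prednK p_gt0).
rewrite size_polyDl topE //.
apply: leq_ltn_trans (size_sum _ _ _) _.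
rewrite -(prednK p_gt0) addSn /=.
apply: (@leq_ltn_trans ((size p).-1 + (size f).-1)).
  apply/bigmax_leqP=> i _; apply: leq_trans (size_scale_leq _ _) _.
  rewrite size_iter_skew_mulX // -{1}(prednK f_gt0) -addSnnS leq_add2r.
  exact: ltn_ord.
by rewrite ltn_add2l prednK.
Qed.

Lemma size_skew_mul_leq (p f : {poly F}) :
  (size (skew_mul delta p f) <= (size p + size f).-1)%N.
Proof.
have [->|p0] := eqVneq p 0; first by rewrite skew_mul0l size_poly0.
have [->|f0] := eqVneq f 0; last by rewrite size_skew_mul.
by rewrite -[skew_mul _ _ _]/((p : R) * 0) mulr0 size_poly0.
Qed.

Lemma skew_mulf_eq0 (p f : R) : p * f = 0 -> p = 0 \/ f = 0.
Proof.
have [->|p0] := eqVneq p 0; first by left.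
have [->|f0] := eqVneq f 0; first by right.
move=> pf0; have := size_skew_mul p0 f0; rewrite -[skew_mul _ _ _]/(p * f) pf0 size_poly0.
move: p0 f0; rewrite -!size_poly_gt0.
by case: (size p) (size f) => [|a] [|b] //; rewrite addnS.
Qed.

Lemma skew_linv_unit (h k : R) : k * h = 1 -> skew_unit h.
Proof.
move=> kh; exists k; split=> //.
have : (h * k - 1) * h = 0 by rewrite mulrBl -mulrA kh mulr1 mul1r subrr.
move=> /skew_mulf_eq0[/eqP|h0]; first by rewrite subr_eq0 => /eqP.
by move/eqP: kh; rewrite h0 mulr0 eq_sym oner_eq0.
Qed.

(** Scaling [d] on the left to a monic [e] preserves its size, and the scalar is absorbed into the
    quotient. *)
Lemma skew_divr (d h : R) : d != 0 ->
  exists q : R, (size ((h - q * d : R)%R : {poly F}) < size (d : {poly F}))%N.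
Proof.
move=> d0; pose c := lead_coef (d : {poly F}).
have c0 : c != 0 by rewrite lead_coef_eq0.
have uc := hF c0.
have cV0 : c^-1 != 0 by apply/eqP=> cV0; move: uc; rewrite -unitrV cV0 unitr0.
pose e : R := skewC delta c^-1 * d.
have eE : e = c^-1 *: d :> {poly F} by rewrite /e skewC_mul.
have sze : size (e : {poly F}) = size (d : {poly F}).
  by rewrite eE lreg_size //; apply: field_axiom_lreg.
have e_monic : skew_monic e.
  by rewrite /skew_monic monicE lead_coefE sze eE coefZ -lead_coefE mulVr.
have [q lt_q] := skew_divr_monic h e_monic.
by exists (q * skewC delta c^-1); rewrite -mulrA -sze.
Qed.

(** * Row vectors as pairs of cofactors *)

(** Covers both the Sylvester matrix and the larger one of [left_common_multiple]. [N] is separate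
    from a + b because the Sylvester size is m + n while its blocks have n, then m rows. *)
Definition shift_mx (f g : R) (a N c : nat) : 'M[F]_(N, c) :=
  \matrix_(i, j) skew_coef (if (i < a)%N then skewX delta ^+ i * f
                            else skewX delta ^+ (i - a) * g) j.

Definition coef_row (p q : R) (a N : nat) : 'rV[F]_N :=
  \row_i (if (i < a)%N then skew_coef p i else skew_coef q (i - a)).

Lemma coef_row_mul (f g p q : R) a b N c (j : 'I_c) : N = (a + b)%N ->
  (size (p : {poly F}) <= a)%N -> (size (q : {poly F}) <= b)%N ->
  (coef_row p q a N *m shift_mx f g a N c) 0 j = skew_coef (p * f + q * g) j.
Proof.
move=> -> le_p le_q; rewrite mxE big_split_ord /= /skew_coef.
rewrite coefD; congr (_ + _).
  rewrite -[p * f]/(skew_mul delta p f) (skew_mul_coef delta f le_p) coef_sum.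
  apply: eq_bigr => i _; rewrite !mxE /= ltn_ord.
  by rewrite coefZ /skew_coef skewXn_mul.
rewrite -[q * g]/(skew_mul delta q g) (skew_mul_coef delta g le_q) coef_sum.
apply: eq_bigr => i _; rewrite !mxE /= ltnNge leq_addr /= addKn.
by rewrite coefZ /skew_coef skewXn_mul.
Qed.

Lemma coef_rowP a b N (v : 'rV[F]_N) : N = (a + b)%N ->
  exists p q : R, [/\ (size (p : {poly F}) <= a)%N,
    (size (q : {poly F}) <= b)%N & v = coef_row p q a N].
Proof.
move=> NE; rewrite {}NE in v *.
(* Extends [v] by zero to all natural indices. *)
pose u i := if insub i is Some k then v 0 k else 0.
exists (\poly_(i < a) u i), (\poly_(i < b) u (a + i)%N); split=> [||]; try exact: size_poly.
apply/rowP=> i; rewrite mxE /skew_coef !coef_poly.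
have uE : u i = v 0 i by rewrite /u valK.
case: ltnP => [//|le_a_i].
by rewrite ltn_subLR // ltn_ord subnKC.
Qed.

(** * The Sylvester matrix and Bezout identities *)

Variables f g : R.
Hypotheses (hf : (0 < skew_deg f)%N) (hg : (0 < skew_deg g)%N).

Let szf : size (f : {poly F}) = (skew_deg f).+1.
Proof. by move: hf; rewrite /skew_deg; case: size. Qed.

Let szg : size (g : {poly F}) = (skew_deg g).+1.
Proof. by move: hg; rewrite /skew_deg; case: size. Qed.

Let f0 : f != 0. Proof. by rewrite -size_poly_gt0 szf. Qed.

Let g0 : g != 0. Proof. by rewrite -size_poly_gt0 szg. Qed.

Lemma dieudonne_rep_sylvester_neq0_bezout :
  dieudonne_rep (skew_sylvester f g) != 0 ->
  exists p q : R, p * f + q * g = 1.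
Proof.
move=> /(dieudonne_rep_neq0_surj hF)/(_ (\row_j skew_coef (1 : R) j))[v vE].
have [p [q [le_p le_q vpq]]] := coef_rowP v (addnC (skew_deg f) (skew_deg g)).
exists p, q; apply/polyP=> j.
have [lt_j|le_j] := ltnP j (skew_deg f + skew_deg g)%N.
  rewrite -[LHS](@coef_row_mul f g p q _ _ _ _ (Ordinal lt_j) (addnC _ _) le_p le_q).
  by rewrite -vpq -[LHS]/((v *m skew_sylvester f g) 0 (Ordinal lt_j)) vE mxE.
rewrite !nth_default //; apply: leq_trans le_j.
  by rewrite size_poly1 addn_gt0 hf.
apply: leq_trans (size_polyD _ _) _; rewrite geq_max; apply/andP; split.
  apply: leq_trans (size_skew_mul_leq p f) _.
  by rewrite szf addnS addnC leq_add2l.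
apply: leq_trans (size_skew_mul_leq q g) _.
by rewrite szg addnS leq_add2r.
Qed.

(** The n + 1 shifts of f and m + 1 shifts of g lie in a space of dimension n + m + 1, hence are
    dependent; s = 0 would force tg = 0 and so t = 0. *)
Lemma left_common_multiple : exists s t : R,
  [/\ s != 0, (size (s : {poly F}) <= (skew_deg g).+1)%N & s * f = t * g].
Proof.
set n := skew_deg g; set m := skew_deg f.
have [v v0 vM] := left_kernel_wide hF
  (shift_mx f g n.+1 (n.+1 + m.+1) (n + m).+1) ltac:(by rewrite addSn addnS).
have [s [t [le_s le_t vst]]] := coef_rowP v erefl.
have st0 : s * f + t * g = 0.
  apply/polyP=> j; rewrite coef0.
  have [lt_j|le_j] := ltnP j (n + m).+1.
    rewrite -[LHS](@coef_row_mul f g s t _ _ _ _ (Ordinal lt_j) erefl le_s le_t).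
    by rewrite -vst vM mxE.
  rewrite nth_default //; apply: leq_trans le_j.
  apply: leq_trans (size_polyD _ _) _; rewrite geq_max; apply/andP; split.
    apply: leq_trans (size_skew_mul_leq s f) _.
    by rewrite szf addnS -[(n + m).+1]addSn leq_add2r.
  apply: leq_trans (size_skew_mul_leq t g) _.
  by rewrite szg addnS -[(n + m).+1]addnS addnC leq_add2l.
exists s, (- t); split=> //; last by apply/eqP; rewrite mulNr -addr_eq0 st0.
apply: contraNneq v0 => s0; move: st0; rewrite s0 mul0r add0r.
move=> /skew_mulf_eq0[t0|g_eq0]; last by move: g0; rewrite g_eq0 eqxx.
by apply/eqP/rowP=> i; rewrite vst s0 t0 !mxE /skew_coef !coef0 if_same.
Qed.

Lemma bezout_dieudonne_rep_sylvester_neq0 :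
  (exists p q : R, p * f + q * g = 1) ->
  dieudonne_rep (skew_sylvester f g) != 0.
Proof.
move=> [p [q pq1]]; apply/eqP=> /(dieudonne_rep_eq0_col hF)[c c0 Mc].
have [s [t [s0 le_s st]]] := left_common_multiple.
have surj (w : 'rV_(skew_deg f + skew_deg g)) :
    exists v, v *m skew_sylvester f g = w.
  (* With an empty second block, [w] is the coefficient row of [h] alone. *)
  have [h [h2 [le_h _ wh]]] := coef_rowP w (esym (addn0 _)).
  have [u lt_u] := skew_divr (h * p) s0.
  (* Since sf = tg, moving us out of the first cofactor and ut into the second leaves the sum h
     unchanged. *)
  set p' : R := h * p - u * s in lt_u; pose q' : R := h * q + u * t.
  have hE : p' * f + q' * g = h.
    rewrite /p' /q' mulrBl mulrDl addrACA -!mulrA st addrC addrA.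
    by rewrite [- _ + _]addrC subrr add0r -mulrDr pq1 mulr1.
  have le_p' : (size (p' : {poly F}) <= skew_deg g)%N.
    by rewrite -ltnS; apply: leq_trans lt_u le_s.
  (* The bound on [q'] comes for free: q'g = h - p'f has degree < m + n, and degrees add. *)
  have le_q'g : (size ((q' * g : R)%R : {poly F}) <= skew_deg f + skew_deg g)%N.
    have -> : q' * g = h - p' * f by rewrite -hE [p' * f + _]addrC addrK.
    apply: leq_trans (size_polyD _ _) _; rewrite geq_max le_h size_polyN /=.
    apply: leq_trans (size_skew_mul_leq p' f) _.
    by rewrite szf addnS addnC leq_add2l.
  have le_q' : (size (q' : {poly F}) <= skew_deg f)%N.
    have [->|q'0] := eqVneq q' 0; first by rewrite size_poly0.
    move: le_q'g; rewrite -[q' * g]/(skew_mul delta q' g) size_skew_mul //.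
    by rewrite szg addnS leq_add2r.
  exists (coef_row p' q' (skew_deg g) _); apply/rowP=> j.
  rewrite (coef_row_mul _ _ _ (addnC _ _) le_p' le_q') hE wh mxE.
  by rewrite ltn_ord.
(* Reaching the basis row at [i] as vM gives c_i = vMc = 0. *)
have /matrix0Pn[i [k]] := c0; rewrite ord1 => /eqP; apply.
have [v vE] := surj (delta_mx 0 i).
have := mulmxA v (skew_sylvester f g) c; rewrite vE Mc mulmx0 -rowE.
by move=> /matrixP/(_ 0 0); rewrite !mxE.
Qed.

Lemma dieudonne_rep_sylvester_eq0 :
  dieudonne_rep (skew_sylvester f g) = 0 <->
  ~ (exists p q : R, p * f + q * g = 1).
Proof.
split=> [rep0 /bezout_dieudonne_rep_sylvester_neq0|nbez].
  by rewrite rep0 eqxx.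
by apply/eqP/negPn/negP=> /dieudonne_rep_sylvester_neq0_bezout.
Qed.

End SkewDivisionRing.

Theorem theorem3p6 (F : unitRingType) (hF : GRing.field_axiom F)
    (sigma : {rmorphism F -> F}) (delta : skew_derivation sigma)
    (f g : skewpoly delta) (hf : (0 < skew_deg f)%N) (hg : (0 < skew_deg g)%N) :
  [<-> skew_resultant f g = dieudonne_class (0 : F);
       exists h : skewpoly delta,
         [/\ ~ skew_unit h, right_factor h f & right_factor h g];
       gcrd f g <> 1;
       ~ (exists p q : skewpoly delta, p * f + q * g = 1);
       (left_ideal2 f g `<` [set: skewpoly delta])%classic].
Proof.
have f0 : f != 0.
  by apply: contraTneq hf => ->; rewrite /skew_deg size_poly0.
have [d_monic dE] := gcrdP (g := g) hF (or_introl f0).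
set d := gcrd f g in d_monic dE *.
tfae.
- move=> /dieudonne_class_eq0/(dieudonne_rep_sylvester_eq0 hF hf hg) nbez.
  exists d; split.
  + move=> [k [kd _]]; apply: nbez.
    have [p [q pq]] : left_ideal2 f g 1 by rewrite -dE; exists k.
    by exists p, q.
  + have : left_ideal1 d f by rewrite dE; exists 1, 0; rewrite mul1r mul0r addr0.
    by case=> u ->; exists u.
  + have : left_ideal1 d g by rewrite dE; exists 0, 1; rewrite mul1r mul0r add0r.
    by case=> u ->; exists u.
- move=> [h [h_nunit [u fE] [w gE]]] d1; apply: h_nunit.
  have [p [q pq1]] : left_ideal2 f g 1 by rewrite -dE d1; exists 1; rewrite mul1r.
  apply: (@skew_linv_unit _ _ _ hF _ (p * u + q * w)).
  by rewrite mulrDl -!mulrA -fE -gE.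
- move=> d_neq1 [p [q pq1]]; apply: d_neq1.
  (* Both [d] and 1 are monic generators of the whole ring. *)
  apply: monic_generator_unique => //; first exact: monic1.
  rewrite dE; apply/seteqP; split=> h _; first by exists h; rewrite mulr1.
  by exists (h * p), (h * q); rewrite -!mulrA -mulrDr pq1 mulr1.
- move=> nbez; split=> // full; apply: nbez.
  by have [p [q pq1]] := full 1 I; exists p, q.
- move=> [_ nfull]; apply/dieudonne_class_eq0.
  apply/(dieudonne_rep_sylvester_eq0 hF hf hg) => -[p [q pq1]]; apply: nfull => h _.
  by exists (h * p), (h * q); rewrite -!mulrA -mulrDr pq1 mulr1.
Qed.
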